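(* Let $k$ be a field of characteristic $0$. If $\mathbb r$ is a noncommutative rational function over $k$ in $x_1,\dots,x_g$ that is regular, i.e. $\operatorname{dom}_n\mathbb r=M_n(k)^g$ for all $n\in\mathbb N$, then $\mathbb r$ is a noncommutative polynomial, i.e. $\mathbb r\in k\langle x_1,\dots,x_g\rangle$.
   Context: Let $k\langle x\rangle=k\langle x_1,\dots,x_g\rangle$ be the free $k$-algebra of noncommutative (nc) polynomials. A nc rational expression is a syntactically valid combination of nc polynomials, the operations $+,\cdot,{}^{-1}$ and parentheses. An expression $r$ can be evaluated at $X\in M_n(k)^g$ (replacing $x_j$ by $X_j$ and $1$ by $I$) whenever all inverses appearing in $r$ exist at $X$; $\operatorname{dom}_n r$ is the set of such $X\in M_n(k)^g$ and $\operatorname{dom} r=\bigcup_n\operatorname{dom}_n r$. The expression $r$ is non-degenerate if $\operatorname{dom} r\ne\emptyset$. Non-degenerate expressions $r_1,r_2$ are equivalent if $r_1(X)=r_2(X)$ for all $X\in\operatorname{dom} r_1\cap\operatorname{dom} r_2$. Nc rational functions are the equivalence classes; they form a skew field containing $k\langle x\rangle$ (the universal skew field of fractions of $k\langle x\rangle$). For a nc rational function $\mathbb r$, $\operatorname{dom}_n\mathbb r$ is the union of $\operatorname{dom}_n r$ over all expressions $r$ representing $\mathbb r$, and $\operatorname{dom}\mathbb r=\bigcup_n\operatorname{dom}_n\mathbb r$. *)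

(* Defs.v *)
From HB Require Import structures.
From mathcomp Require Import all_boot all_order all_algebra.
From mathcomp Require Import monalg.

Set Implicit Arguments.
Unset Strict Implicit.
Unset Printing Implicit Defensive.

Import GRing.Theory.
Local Open Scope ring_scope.

(* k<x_1, ..., x_g>: the algebra over k of the free monoid on 'I_g. *)
Definition ncpoly (k : fieldType) (g : nat) : Type := {malg k[{fmonom 'I_g}]}.

Inductive ncexpr (k : fieldType) (g : nat) : Type :=
| NCPoly of ncpoly k g
| NCAdd of ncexpr k g & ncexpr k g
| NCMul of ncexpr k g & ncexpr k g
| NCInv of ncexpr k g.

(* Matrix sizes are positive throughout: the size is written n.+1.  (A 0 x 0  *)
(* matrix is always invertible, so size 0 would make every expression         *)
(* non-degenerate.)                                                           *)
Definition mxpoint (k : fieldType) (g n : nat) : Type := 'I_g -> 'M[k]_n.+1.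

Definition ncpoly_eval (k : fieldType) (g n : nat) (X : mxpoint k g n)
    (p : ncpoly k g) : 'M[k]_n.+1 :=
  mmap (fun c : k => c%:M) (fun w : {fmonom 'I_g} => \prod_(i <- w) X i) p.

(* Total evaluation; the value is meaningful only where ncexpr_dom holds,     *)
(* since _^-1 returns its argument on non-invertible matrices.                *)
Fixpoint ncexpr_eval (k : fieldType) (g n : nat) (X : mxpoint k g n)
    (r : ncexpr k g) : 'M[k]_n.+1 :=
  match r with
  | NCPoly p => ncpoly_eval X p
  | NCAdd r1 r2 => ncexpr_eval X r1 + ncexpr_eval X r2
  | NCMul r1 r2 => ncexpr_eval X r1 * ncexpr_eval X r2
  | NCInv r1 => (ncexpr_eval X r1)^-1
  end.

Fixpoint ncexpr_dom (k : fieldType) (g n : nat) (r : ncexpr k g)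
    (X : mxpoint k g n) : bool :=
  match r with
  | NCPoly _ => true
  | NCAdd r1 r2 | NCMul r1 r2 => ncexpr_dom r1 X && ncexpr_dom r2 X
  | NCInv r1 => ncexpr_dom r1 X && (ncexpr_eval X r1 \is a GRing.unit)
  end.

Definition nondegenerate (k : fieldType) (g : nat) (r : ncexpr k g) : Prop :=
  exists (n : nat) (X : mxpoint k g n), ncexpr_dom r X.

Definition ncexpr_equiv (k : fieldType) (g : nat) (r1 r2 : ncexpr k g) : Prop :=
  forall (n : nat) (X : mxpoint k g n),
    ncexpr_dom r1 X -> ncexpr_dom r2 X -> ncexpr_eval X r1 = ncexpr_eval X r2.

(* A nc rational function is an equivalence class of non-degenerate           *)
(* expressions; represents f is the class itself, as a predicate.             *)
Record ncratfun (k : fieldType) (g : nat) : Type := NCRatFun {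
  represents :> ncexpr k g -> Prop;
  represents_class : exists2 r : ncexpr k g, nondegenerate r &
    forall s, represents s <-> nondegenerate s /\ ncexpr_equiv r s
}.

Definition ncratfun_dom (k : fieldType) (g n : nat) (f : ncratfun k g)
    (X : mxpoint k g n) : Prop :=
  exists2 r : ncexpr k g, f r & ncexpr_dom r X.

Definition regular (k : fieldType) (g : nat) (f : ncratfun k g) : Prop :=
  forall (n : nat) (X : mxpoint k g n), ncratfun_dom f X.

(* Membership in the image of k<x>, which embeds by sending a polynomial to   *)
(* the class of the expression consisting of that polynomial alone.           *)
Definition is_ncpoly (k : fieldType) (g : nat) (f : ncratfun k g) : Prop :=
  exists p : ncpoly k g, f (NCPoly p).

(* Main.v *)
(* Linearize an expression [r] as a linear system M P0 = sum_i X_i M P_i + v c *)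
(* whose solution M gives r(X) v = M b; this avoids Kronecker products, and the *)
(* system is nonsingular wherever [r] is defined.  If [r] is defined at 0, then *)
(* P0 can be normalized to 1, and the system (A, b, c) can be made minimal.     *)
(* Regularity makes the output of M = t sum_i X_i M A_i + v c free of poles at  *)
(* t = 1, and, evaluating at block triangular points, minimality propagates    *)
(* this to all entries of M and to every free term.  If W = sum_i X_i W A_i,    *)
(* then the free term W has the solution M = W / (1 - t), so W = 0.  Applied to *)
(* the eventual value of the decreasing chain V_0 = k^d,                        *)
(* V_(m+1) = sum_i V_m A_i, this shows that all products of d of the A_i        *)
(* vanish, hence the geometric series solving the system is a polynomial.       *)
Require Import Defs.
From mathcomp Require Import all_boot all_order all_algebra.
From mathcomp Require Import finmap monalg.
From mathcomp Require Import mxtens.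
From Stdlib Require Import Classical_Prop FunctionalExtensionality.

Set Implicit Arguments.
Unset Strict Implicit.
Unset Printing Implicit Defensive.

Import GRing.Theory.
Local Open Scope ring_scope.

(** A minimal system cannot hide a singularity: a pole of its solution reaches the output unless
    part of the solution is unreachable or invisible. Regularity provides, for each [X], a
    representative defined at [X], so the output along the ray [tX] has no pole at [t = 1]
    ([regular_at1_output]). As [X] is arbitrary, block triangular points let words in the [A_i] act
    on both ends of the system, and minimality extends this to the whole solution
    ([regular_at1_all]). A nonzero fixed point of [sylv X A] would be a pole, so there is none at
    any point of any size ([sylv_no_fixpoint]). This forces joint nilpotency of the [A_i]
    ([image_power_eq0]), after which the Neumann series stops and is a polynomial
    ([realizes_ncpoly]). Representatives with different domains are compared along curves, where
    expressions are polynomial matrices over a scalar denominator ([ncexpr_curve],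
    [poly_generic]). *)

Definition sylv (k : fieldType) (g n d : nat) (X : mxpoint k g n)
    (A : 'I_g -> 'M[k]_d) (M : 'M[k]_(n.+1, d)) : 'M[k]_(n.+1, d) :=
  \sum_i X i *m M *m A i.

Lemma sylvD (k : fieldType) (g n d : nat) (X : mxpoint k g n)
    (A : 'I_g -> 'M[k]_d) (M N : 'M[k]_(n.+1, d)) :
  sylv X A (M + N) = sylv X A M + sylv X A N.
Proof.
by rewrite /sylv -big_split; apply: eq_bigr => i _; rewrite mulmxDr mulmxDl.
Qed.

Lemma sylvZ (k : fieldType) (g n d : nat) (X : mxpoint k g n)
    (A : 'I_g -> 'M[k]_d) (a : k) (M : 'M[k]_(n.+1, d)) :
  sylv X A (a *: M) = a *: sylv X A M.
Proof.
by rewrite /sylv scaler_sumr; apply: eq_bigr => i _; rewrite -scalemxAr -scalemxAl.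
Qed.

Lemma sylvB (k : fieldType) (g n d : nat) (X : mxpoint k g n)
    (A : 'I_g -> 'M[k]_d) (M N : 'M[k]_(n.+1, d)) :
  sylv X A (M - N) = sylv X A M - sylv X A N.
Proof. by rewrite -!scaleN1r sylvD sylvZ. Qed.

Lemma sylv0 (k : fieldType) (g n d : nat) (X : mxpoint k g n)
    (A : 'I_g -> 'M[k]_d) : sylv X A 0 = 0.
Proof. by rewrite /sylv big1 // => i _; rewrite mulmx0 mul0mx. Qed.

Lemma sylv_scale_point (k : fieldType) (g n d : nat) (X : mxpoint k g n)
    (A : 'I_g -> 'M[k]_d) (t : k) (M : 'M[k]_(n.+1, d)) :
  sylv (fun i => t *: X i) A M = t *: sylv X A M.
Proof.
by rewrite /sylv scaler_sumr; apply: eq_bigr => i _; rewrite -!scalemxAl.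
Qed.

Lemma sylv_zero_pencil (k : fieldType) (g n d : nat) (X : mxpoint k g n)
    (M : 'M[k]_(n.+1, d)) : sylv X (fun=> 0) M = 0.
Proof. by rewrite /sylv big1 // => i _; rewrite mulmx0. Qed.

Lemma sylv_row_block (k : fieldType) (g n d1 d2 : nat) (X : mxpoint k g n)
    (A : 'I_g -> 'M[k]_(d1, d1)) (B : 'I_g -> 'M[k]_(d1, d2))
    (C : 'I_g -> 'M[k]_(d2, d1)) (D : 'I_g -> 'M[k]_(d2, d2))
    (M1 : 'M[k]_(n.+1, d1)) (M2 : 'M[k]_(n.+1, d2)) :
  sylv X (fun i => block_mx (A i) (B i) (C i) (D i)) (row_mx M1 M2) =
  row_mx (\sum_i (X i *m M1 *m A i + X i *m M2 *m C i))
         (\sum_i (X i *m M1 *m B i + X i *m M2 *m D i)).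
Proof.
rewrite /sylv (eq_bigr (fun i => row_mx (X i *m M1 *m A i + X i *m M2 *m C i)
  (X i *m M1 *m B i + X i *m M2 *m D i))); last first.
  by move=> i _; rewrite mul_mx_row mul_row_block.
elim/big_rec3: _ => [|i x y z _ ->]; first by rewrite row_mx0.
by rewrite add_row_mx.
Qed.

Lemma sylv_row_diag (k : fieldType) (g n d1 d2 : nat) (X : mxpoint k g n)
    (A : 'I_g -> 'M[k]_d1) (D : 'I_g -> 'M[k]_d2)
    (M1 : 'M[k]_(n.+1, d1)) (M2 : 'M[k]_(n.+1, d2)) :
  sylv X (fun i => block_mx (A i) 0 0 (D i)) (row_mx M1 M2) =
  row_mx (sylv X A M1) (sylv X D M2).
Proof.
rewrite (sylv_row_block X A (fun=> 0) (fun=> 0) D).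
by congr row_mx; apply: eq_bigr => i _; rewrite mulmx0 ?addr0 ?add0r.
Qed.

(* Both clauses together say that [F X v] is the output [M b] of the unique     *)
(* solution [M] of the system with input [v].                                   *)
Definition realizes (k : fieldType) (g d : nat)
    (F : forall n, mxpoint k g n -> 'M[k]_n.+1)
    (D : forall n, mxpoint k g n -> bool)
    (P0 : 'M[k]_d) (P : 'I_g -> 'M[k]_d) (b : 'cV[k]_d) (c : 'rV[k]_d) : Prop :=
  forall n (X : mxpoint k g n), D n X ->
    (forall M, M *m P0 = sylv X P M -> M = 0) /\
    (forall M v, M *m P0 = sylv X P M + v *m c -> M *m b = F n X *m v).

Definition realizable (k : fieldType) (g : nat)
    (F : forall n, mxpoint k g n -> 'M[k]_n.+1)
    (D : forall n, mxpoint k g n -> bool) : Prop :=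
  exists d P0 P b c, @realizes k g d F D P0 P b c.

(** * Linear systems for polynomials and the rational operations *)

Lemma realizable_const (k : fieldType) (g : nat) (a : k) D :
  realizable (fun n (X : mxpoint k g n) => a%:M) D.
Proof.
exists 1, 1%:M, (fun=> 0), a%:M, 1%:M => n X _; split=> [M|M v];
  rewrite sylv_zero_pencil !mulmx1 ?add0r // => ->.
by rewrite mul_mx_scalar mul_scalar_mx.
Qed.

(** The solution has blocks [X_i v] and [v]: [c] loads [v] into the second block, the pencil carries
    it to the first, and [b] reads the first. *)
Lemma realizable_var (k : fieldType) (g : nat) (i : 'I_g) D :
  realizable (fun n (X : mxpoint k g n) => X i) D.
Proof.
exists (1 + 1)%N, 1%:M,
  (fun j => block_mx (0 : 'M_1) 0 (j == i)%:R%:M (0 : 'M_1)),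
  (col_mx 1%:M 0), (row_mx 0 1%:M) => n X _.
have E (M1 M2 : 'M[k]_(n.+1, 1)) :
    sylv X (fun j => block_mx (0 : 'M_1) 0 (j == i)%:R%:M (0 : 'M_1))
      (row_mx M1 M2) = row_mx (X i *m M2) 0.
  rewrite (sylv_row_block X (fun=> 0) (fun=> 0) (fun j => (j == i)%:R%:M)
    (fun=> 0)); congr row_mx; last first.
    by rewrite big1 // => j _; rewrite !mulmx0 addr0.
  rewrite (bigD1 i) //= eqxx mulmx0 add0r mulmx1 big1 ?addr0 // => j /negPf->.
  by rewrite mulmx0 add0r /= raddf0 mulmx0.
split=> [M|M v]; rewrite -(hsubmxK M) E mulmx1.
  move/eq_row_mx=> [-> ->].
  by rewrite mulmx0 row_mx0.
rewrite mul_mx_row mulmx0 mulmx1 add_row_mx addr0 add0r => /eq_row_mx[-> ->].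
by rewrite mul_row_col mulmx1 mulmx0 addr0.
Qed.

Lemma realizableD (k : fieldType) (g : nat) F1 F2 D1 D2 :
  @realizable k g F1 D1 -> @realizable k g F2 D2 ->
  realizable (fun n (X : mxpoint k g n) => F1 n X + F2 n X)
    (fun n X => D1 n X && D2 n X).
Proof.
move=> [d1 [P01 [P1 [b1 [c1 R1]]]]] [d2 [P02 [P2 [b2 [c2 R2]]]]].
exists (d1 + d2)%N, (block_mx P01 0 0 P02),
  (fun i => block_mx (P1 i) 0 0 (P2 i)), (col_mx b1 b2), (row_mx c1 c2).
move=> n X /andP[/R1[i1 e1] /R2[i2 e2]]; split=> [M|M v];
  rewrite -(hsubmxK M) mul_row_block !mulmx0 addr0 add0r sylv_row_diag.
  by move/eq_row_mx=> [/i1-> /i2->]; rewrite row_mx0.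
rewrite mul_mx_row add_row_mx => /eq_row_mx[/e1 h1 /e2 h2].
by rewrite mul_row_col h1 h2 mulmxDl.
Qed.

(** Cascade: the output [M2 b2 = F2(X) v] of the second system is fed to the first through the
    corner [-(b2 c1)]. *)
Lemma realizableM (k : fieldType) (g : nat) F1 F2 D1 D2 :
  @realizable k g F1 D1 -> @realizable k g F2 D2 ->
  realizable (fun n (X : mxpoint k g n) => F1 n X * F2 n X)
    (fun n X => D1 n X && D2 n X).
Proof.
move=> [d1 [P01 [P1 [b1 [c1 R1]]]]] [d2 [P02 [P2 [b2 [c2 R2]]]]].
exists (d1 + d2)%N, (block_mx P01 0 (- (b2 *m c1)) P02),
  (fun i => block_mx (P1 i) 0 0 (P2 i)), (col_mx b1 0), (row_mx 0 c2).
move=> n X /andP[/R1[i1 e1] /R2[i2 e2]]; split=> [M|M v];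
  rewrite -(hsubmxK M) mul_row_block !mulmx0 add0r sylv_row_diag.
  move/eq_row_mx=> [h /i2 h2]; move: h; rewrite h2 mul0mx addr0 => /i1->.
  by rewrite row_mx0.
rewrite mul_mx_row mulmx0 add_row_mx addr0 mulmxN mulmxA.
move=> /eq_row_mx[/eqP + /e2 h2]; rewrite subr_eq => /eqP/e1 h1.
by rewrite mul_row_col mulmx0 addr0 h1 h2 mulmxA.
Qed.

(* [y = F(X)^-1 v] is read off the pencil of [F] as the unknown right-hand     *)
(* side for which the output is [v]: the unknown is the pair [(M, y)].         *)
Lemma realizableV (k : fieldType) (g : nat) F D :
  @realizable k g F D ->
  realizable (fun n (X : mxpoint k g n) => (F n X)^-1)
    (fun n X => D n X && (F n X \is a GRing.unit)).
Proof.
move=> [d [P0 [P [b [c R]]]]].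
exists (d + 1)%N, (block_mx P0 b (- c) 0), (fun i => block_mx (P i) 0 0 0),
  (col_mx 0 1%:M), (row_mx 0 1%:M) => n X /andP[/R[i e] u].
have Vu : (F n X)^-1 *m F n X = 1%:M := mulVr u.
split=> [M|M v]; rewrite -(hsubmxK M); move: (lsubmx M) (rsubmx M) => {}M y;
  rewrite mul_row_block mulmx0 addr0 mulmxN (sylv_row_diag X P (fun=> 0));
  rewrite sylv_zero_pencil.
  move/eq_row_mx=> [/eqP]; rewrite subr_eq => /eqP h; move: (e _ _ h) => -> h2.
  have y0 : y = 0 by rewrite -[y]mul1mx -Vu -mulmxA h2 mulmx0.
  by move: h; rewrite y0 mul0mx addr0 => /i->; rewrite row_mx0.
rewrite mul_mx_row mulmx0 mulmx1 add_row_mx addr0 add0r => /eq_row_mx[/eqP].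
rewrite subr_eq => /eqP/e -> <-.
by rewrite mul_row_col mulmx0 add0r mulmx1 mulmxA Vu mul1mx.
Qed.

Lemma realizable_ext (k : fieldType) (g : nat) F1 F2 D1 D2 :
  realizable F1 D1 ->
  (forall n (X : mxpoint k g n), D1 n X = D2 n X) ->
  (forall n (X : mxpoint k g n), F1 n X = F2 n X) ->
  realizable F2 D2.
Proof.
move=> [d [P0 [P [b [c R]]]]] eD eF; exists d, P0, P, b, c => n X.
by rewrite -eD => /R; rewrite eF.
Qed.

Lemma realizable_monomial (k : fieldType) (g : nat) (w : seq 'I_g) :
  realizable (fun n (X : mxpoint k g n) => \prod_(i <- w) X i) (fun _ _ => true).
Proof.
elim: w => [|i w IHw].
  apply: (realizable_ext (@realizable_const k g 1 (fun _ _ => true))) => // n X.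
  by rewrite big_nil.
apply: (realizable_ext (realizableM (@realizable_var k g i (fun _ _ => true)) IHw)).
  by [].
by move=> n X; rewrite big_cons.
Qed.

Lemma realizable_ncpoly (k : fieldType) (g : nat) (p : ncpoly k g) :
  realizable (fun n (X : mxpoint k g n) => ncpoly_eval X p) (fun _ _ => true).
Proof.
suff: forall s, realizable (fun n (X : mxpoint k g n) =>
  \sum_(w <- s) (p@_w)%:M * \prod_(i <- (w : {fmonom 'I_g})) X i)
  (fun _ _ => true) by exact.
elim=> [|w s IHs].
  apply: (realizable_ext (@realizable_const k g 0 (fun _ _ => true))) => // n X.
  by rewrite big_nil raddf0.
apply: (realizable_ext (realizableD (realizableM
  (@realizable_const k g p@_w (fun _ _ => true)) (realizable_monomial k w)) IHs)).
  by [].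
by move=> n X; rewrite big_cons.
Qed.

Lemma realizable_ncexpr (k : fieldType) (g : nat) (r : ncexpr k g) :
  realizable (fun n (X : mxpoint k g n) => ncexpr_eval X r)
    (fun n X => ncexpr_dom r X).
Proof.
elim: r => [p|r1 IH1 r2 IH2|r1 IH1 r2 IH2|r IH] /=.
- exact: realizable_ncpoly.
- exact: realizableD.
- exact: realizableM.
- exact: realizableV.
Qed.

(** * Normalization and minimality *)

Lemma sylv_mulmx (k : fieldType) (g n d e : nat) (X : mxpoint k g n)
    (A : 'I_g -> 'M[k]_e) (A' : 'I_g -> 'M[k]_d) (B : 'M[k]_(d, e))
    (M : 'M[k]_(n.+1, d)) :
  (forall i, B *m A i = A' i *m B) -> sylv X A (M *m B) = sylv X A' M *m B.
Proof.
move=> h; rewrite /sylv mulmx_suml; apply: eq_bigr => i _.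
by rewrite mulmxA -mulmxA h !mulmxA.
Qed.

(** [M - sylv X A M] is an endomorphism of a finite-dimensional space, with matrix [U] on
    [mxvec]. *)
Lemma sylv_inj_surj (k : fieldType) (g n d : nat) (X : mxpoint k g n)
    (A : 'I_g -> 'M[k]_d) :
  (forall M, M = sylv X A M -> M = 0) <->
  (forall N, exists M, M = sylv X A M + N).
Proof.
pose L : 'M_(n.+1 * d) :=
  \sum_i lin_mx (mulmx (X i)) *m lin_mx (mulmxr (A i)).
have LE M : mxvec M *m L = mxvec (sylv X A M).
  rewrite mulmx_sumr /sylv raddf_sum /=; apply: eq_bigr => i _.
  by rewrite mulmxA !mul_vec_lin.
pose U := 1%:M - L.
have UE M : mxvec M *m U = mxvec (M - sylv X A M).
  by rewrite mulmxBr mulmx1 LE raddfB.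
split=> [inj N|surj M eM].
  have uU : U \in unitmx.
    rewrite -row_free_unit; apply: inj_row_free => v.
    rewrite -[v]vec_mxK UE => h; rewrite (inj (vec_mx v)) ?raddf0 //.
    by apply/eqP; rewrite -subr_eq0 -[_ - _]mxvecK h raddf0.
  exists (vec_mx (mxvec N *m invmx U)); set M := vec_mx _.
  apply/eqP; rewrite addrC -subr_eq; apply/eqP.
  by rewrite -[LHS]mxvecK -UE vec_mxK mulmxKV // mxvecK.
have uU : U \in unitmx.
  rewrite -row_full_unit -sub1mx; apply/row_subP => i.
  have [N eN] := surj (vec_mx (row i 1%:M)).
  apply/submxP; exists (mxvec N).
  by rewrite UE {1}eN addrAC subrr add0r vec_mxK.
by rewrite -[M]mxvecK -[mxvec M](mulmxK uU) UE -eM subrr raddf0 mul0mx raddf0.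
Qed.

(** At the zero point of size 1 the pencil vanishes, so uniqueness there makes [P0] injective on
    rows; [M P0] is the new unknown. *)
Lemma realizes_normalize (k : fieldType) (g d : nat) F
    (D : forall n, mxpoint k g n -> bool)
    (P0 : 'M[k]_d) (P : 'I_g -> 'M[k]_d) b c :
  D 0%N (fun=> 0) -> realizes F D P0 P b c ->
  exists A b', @realizes k g d F D 1%:M A b' c.
Proof.
move=> D0 R; have uP0 : P0 \in unitmx.
  rewrite -row_free_unit; apply: inj_row_free => v v0.
  apply: (R 0%N (fun=> 0) D0).1; rewrite v0 /sylv big1 // => i _.
  by rewrite !mul0mx.
exists (fun i => invmx P0 *m P i), (invmx P0 *m b) => n X /R[inj out].
have E M : sylv X (fun i => invmx P0 *m P i) M = sylv X P (M *m invmx P0).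
  by apply: eq_bigr => i _; rewrite !mulmxA.
split=> [M|M v]; rewrite mulmx1 E => h.
  by rewrite -[M](mulmxKV uP0) (inj (M *m invmx P0)) ?mul0mx ?mulmxKV.
by rewrite mulmxA; apply: out; rewrite mulmxKV.
Qed.

(** Equivalently, the rows [c A_w] over all words [w] span the space. *)
Definition observable (k : fieldType) (g d : nat) (A : 'I_g -> 'M[k]_d)
    (c : 'rV[k]_d) : Prop :=
  forall S : 'M[k]_d, (c <= S)%MS -> (forall i, (S *m A i <= S)%MS) ->
    row_full S.

Definition controllable (k : fieldType) (g d : nat) (A : 'I_g -> 'M[k]_d)
    (b : 'cV[k]_d) : Prop :=
  observable (fun i => (A i)^T) b^T.

Lemma realizes_restrict (k : fieldType) (g d e : nat) F
    (D : forall n, mxpoint k g n -> bool) (A : 'I_g -> 'M[k]_d) b c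
    (A' : 'I_g -> 'M[k]_e) (c' : 'rV[k]_e) (B : 'M[k]_(e, d)) :
  row_free B -> (forall i, B *m A i = A' i *m B) -> c = c' *m B ->
  realizes F D 1%:M A b c -> realizes F D 1%:M A' (B *m b) c'.
Proof.
move=> fB eA -> R n X /R[inj out]; split=> [M|M v]; rewrite mulmx1 => h.
  apply: (row_free_inj fB); rewrite mul0mx; apply: inj.
  by rewrite mulmx1 (sylv_mulmx X M eA) -h.
rewrite mulmxA; apply: out.
by rewrite mulmx1 (sylv_mulmx X M eA) mulmxA -mulmxDl -h.
Qed.

(** [M |-> M T] maps solutions of the large system to the small one, so it is solvability that
    descends; [sylv_inj_surj] turns it back into uniqueness. *)
Lemma realizes_quotient (k : fieldType) (g d e : nat) F
    (D : forall n, mxpoint k g n -> bool) (A : 'I_g -> 'M[k]_d) b c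
    (A' : 'I_g -> 'M[k]_e) (b' : 'cV[k]_e) (T : 'M[k]_(d, e)) :
  row_full T -> (forall i, A i *m T = T *m A' i) -> b = T *m b' ->
  realizes F D 1%:M A b c -> realizes F D 1%:M A' b' (c *m T).
Proof.
move=> /row_fullP[T' T'T] eA -> R n X /R[inj out].
have eX M : sylv X A M *m T = sylv X A' (M *m T).
  by rewrite (sylv_mulmx X M (fun i => esym (eA i))).
have surj : forall N, exists M, M = sylv X A M + N.
  by apply/sylv_inj_surj => M h; apply: inj; rewrite mulmx1.
have inj' : forall M, M = sylv X A' M -> M = 0.
  apply/sylv_inj_surj => N; have [M eM] := surj (N *m T').
  by exists (M *m T); rewrite {1}eM mulmxDl eX -mulmxA T'T mulmx1.
split=> [M|M v]; rewrite mulmx1 => h; first exact: inj'.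
have [M1 eM1] := surj (v *m c).
have -> : M = M1 *m T.
  apply/eqP; rewrite -subr_eq0; apply/eqP/inj'.
  rewrite sylvB -eX {1}h {1}eM1 mulmxDl -mulmxA opprD addrACA subrr addr0.
  by [].
by rewrite -mulmxA; apply: out; rewrite mulmx1.
Qed.

Lemma observableVinvariant (k : fieldType) (g d : nat) (A : 'I_g -> 'M[k]_d)
    (c : 'rV[k]_d) :
  observable A c \/
  exists e (A' : 'I_g -> 'M[k]_e) (c' : 'rV[k]_e) (B : 'M[k]_(e, d)),
    [/\ (e < d)%N, row_free B, forall i, B *m A i = A' i *m B & c = c' *m B].
Proof.
have [|nobs] := classic (exists S : 'M[k]_d,
    [/\ (c <= S)%MS, forall i, (S *m A i <= S)%MS & ~~ row_full S]).
  move=> [S [cS SA nS]]; right; pose B := row_base S.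
  exists (\rank S), (fun i => B *m A i *m pinvmx B), (c *m pinvmx B), B; split.
  - by move: nS; rewrite /row_full ltn_neqAle rank_leq_col andbT.
  - exact: row_base_free.
  - move=> i; rewrite mulmxKpV // eq_row_base.
    by apply: submx_trans (SA i); rewrite submxMr // eq_row_base.
  - by rewrite mulmxKpV // eq_row_base.
left=> S cS SA; case: (boolP (row_full S)) => // nS.
by case: nobs; exists S.
Qed.

(** Failure of observability gives a proper invariant row space to restrict to; failure of
    controllability gives, by transposition, a proper quotient. Both lower [d]. *)
Lemma exists_minimal_realization (k : fieldType) (g d : nat) F
    (D : forall n, mxpoint k g n -> bool) (A : 'I_g -> 'M[k]_d) b c :
  realizes F D 1%:M A b c ->
  exists d' (A' : 'I_g -> 'M[k]_d') b' c',
    [/\ realizes F D 1%:M A' b' c', observable A' c' & controllable A' b'].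
Proof.
elim/ltn_ind: d A b c => d IHd A b c R.
have [obs|[e [A' [c' [B [ed fB eA ec]]]]]] := observableVinvariant A c; last first.
  exact: IHd ed _ _ _ (realizes_restrict fB eA ec R).
have [ctr|[e [A' [c' [B [ed fB eA ec]]]]]] :=
    observableVinvariant (fun i => (A i)^T) b^T; last first.
  apply: IHd ed (fun i => (A' i)^T) c'^T (c *m B^T) _.
  apply: (@realizes_quotient _ _ _ _ _ _ A b) R.
  - by move: fB; rewrite /row_free /row_full mxrank_tr.
  - by move=> i; apply: trmx_inj; rewrite !trmx_mul !trmxK eA.
  - by apply: trmx_inj; rewrite ec trmx_mul !trmxK.
by exists d, A, b, c.
Qed.

(** * Expressions along polynomial curves *)

Definition curve (k : fieldType) (g n : nat) (Y : 'I_g -> 'M[{poly k}]_n.+1)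
    (t : k) : mxpoint k g n := fun i => map_mx (horner_eval t) (Y i).

(** Along a curve the value is [P / q], where the single [q] controls both the poles and the
    domain. *)
Lemma ncexpr_curve (k : fieldType) (g n : nat)
    (Y : 'I_g -> 'M[{poly k}]_n.+1) (t0 : k) (r : ncexpr k g) :
  ncexpr_dom r (curve Y t0) ->
  exists (q : {poly k}) (P : 'M[{poly k}]_n.+1), q.[t0] != 0 /\
    forall t, q.[t] != 0 -> ncexpr_dom r (curve Y t) /\
      q.[t] *: ncexpr_eval (curve Y t) r = map_mx (horner_eval t) P.
Proof.
elim: r => [p|r1 IH1 r2 IH2|r1 IH1 r2 IH2|r IH] /=.
- move=> _; exists 1, (\sum_(w <- msupp p) (p@_w)%:P%:M * \prod_(i <- w) Y i).
  split=> [|t _]; first by rewrite hornerC oner_neq0.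
  split=> //; rewrite hornerC scale1r /ncpoly_eval /mmap rmorph_sum.
  apply: eq_bigr => w _; rewrite rmorphM rmorph_prod; congr (_ * _).
  by rewrite /= map_scalar_mx /= /horner_eval hornerC.
- move=> /andP[/IH1[q1 [P1 [q10 e1]]] /IH2[q2 [P2 [q20 e2]]]].
  exists (q1 * q2), (q2 *: P1 + q1 *: P2); rewrite hornerM mulf_neq0 //.
  split=> // t; rewrite hornerM mulf_eq0 negb_or => /andP[/e1[-> h1] /e2[-> h2]].
  split=> //; rewrite map_mxD !map_mxZ /= -h1 -h2 scalerDr !scalerA /horner_eval.
  by rewrite [q2.[t] * _]mulrC.
- move=> /andP[/IH1[q1 [P1 [q10 e1]]] /IH2[q2 [P2 [q20 e2]]]].
  exists (q1 * q2), (P1 * P2); rewrite hornerM mulf_neq0 //.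
  split=> // t; rewrite hornerM mulf_eq0 negb_or => /andP[/e1[-> h1] /e2[-> h2]].
  by split=> //; rewrite rmorphM /= -h1 -h2 -scalerAl -scalerAr scalerA.
- move=> /andP[/IH[q [P [q0 e]]] u].
  have unitP t : q.[t] != 0 -> ((\det P).[t] != 0) =
      (ncexpr_eval (curve Y t) r \is a GRing.unit).
    move=> qt; have [_ h] := e t qt.
    rewrite -[(\det P).[t]]/(horner_eval t (\det P)) -det_map_mx -h detZ.
    by rewrite mulf_eq0 expf_eq0 (negPf qt) andbF -unitfE.
  (* From [r = P / q] follows [r^-1 = q adj(P) / det P]; one more factor [q] on both sides keeps the
     domain of [r] guarded. *)
  exists (q * \det P), (q ^+ 2 *: \adj P).
  rewrite hornerM mulf_neq0 ?unitP //; split=> // t.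
  rewrite hornerM mulf_eq0 negb_or => /andP[qt].
  rewrite unitP // => ut; have [-> h] := e t qt; split; first by rewrite ut.
  apply: (mulrI ut); rewrite -scalerAr mulrV // map_mxZ map_mx_adj /=.
  rewrite -scalerAr /horner_eval horner_exp expr2 -!scalerA; congr (_ *: _).
  rewrite scalerAl h -[_ * _]/(_ *m _) mul_mx_adj det_map_mx.
  by rewrite -scalemx1.
Qed.

(** [e (p - q)] vanishes on all of [k], hence at [0, 1, 2, ...], which are distinct in
    characteristic 0: too many roots for a nonzero polynomial. *)
Lemma poly_generic (k : fieldType) (char_k0 : [pchar k] =i pred0)
    (e p q : {poly k}) :
  e != 0 -> (forall t, e.[t] != 0 -> p.[t] = q.[t]) -> p = q.
Proof.
move=> e0 h; apply/eqP; rewrite -subr_eq0; apply: contraT => pq0.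
have : e * (p - q) != 0 by rewrite mulf_neq0.
set s := e * _ => s0.
have s_root t : root s t.
  rewrite /root hornerM hornerD hornerN.
  by have [->|/h->] := eqVneq e.[t] 0; rewrite ?mul0r // subrr mulr0.
pose rs : seq k := [seq m%:R | m <- iota 0 (size s)].
have rs_uniq : uniq rs.
  rewrite map_inj_in_uniq ?iota_uniq // => a b _ _.
  wlog ab : a b / (a <= b)%N.
    by move=> H /[dup] h1 /esym h2; case/orP: (leq_total a b) => l;
      [exact: H | apply/esym/H].
  move/eqP; rewrite eq_sym -subr_eq0 -natrB // ((pcharf0P k).1 char_k0) subn_eq0.
  by move=> ba; apply/eqP; rewrite eqn_leq ab.
have /(max_poly_roots s0)/(_ rs_uniq) : all (root s) rs by apply/allP.
by rewrite size_map size_iota ltnn.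
Qed.

Lemma polymx_generic (k : fieldType) (char_k0 : [pchar k] =i pred0) (m n : nat)
    (e : {poly k}) (P Q : 'M[{poly k}]_(m, n)) :
  e != 0 ->
  (forall t, e.[t] != 0 ->
    map_mx (horner_eval t) P = map_mx (horner_eval t) Q) -> P = Q.
Proof.
move=> e0 h; apply/matrixP => i j; apply: poly_generic char_k0 _ _ _ e0 _ => t.
by move=> /h/matrixP/(_ i j); rewrite !mxE.
Qed.

Lemma horner_neq0_poly (k : fieldType) (p : {poly k}) (t : k) :
  p.[t] != 0 -> p != 0.
Proof. by apply: contraNneq => ->; rewrite horner0. Qed.

(** * Change of matrix size and comparison of representatives *)

Lemma ncexpr_hom (k : fieldType) (g n m : nat)
    (phi : 'M[k]_n.+1 -> 'M[k]_m.+1)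
    (phiD : {morph phi : A B / A + B >-> A + B})
    (phiM : {morph phi : A B / A * B >-> A * B})
    (phiC : forall a, phi a%:M = a%:M) (X : mxpoint k g n) (r : ncexpr k g) :
  ncexpr_dom r X -> ncexpr_dom r (fun i => phi (X i)) /\
  ncexpr_eval (fun i => phi (X i)) r = phi (ncexpr_eval X r).
Proof.
have phi0 : phi 0 = 0 by rewrite -(raddf0 (@scalar_mx k n.+1)) phiC raddf0.
have phi1 : phi 1 = 1 by exact: phiC.
elim: r => [p|r1 IH1 r2 IH2|r1 IH1 r2 IH2|r IH] /=.
- move=> _; split=> //; rewrite /ncpoly_eval /mmap (big_morph phi phiD phi0).
  apply: eq_bigr => w _.
  by rewrite phiM phiC (big_morph phi phiM phi1).
- by move=> /andP[/IH1[-> ->] /IH2[-> ->]]; rewrite phiD.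
- by move=> /andP[/IH1[-> ->] /IH2[-> ->]]; rewrite phiM.
- move=> /andP[/IH[-> ->] u].
  have u' : phi (ncexpr_eval X r) \is a GRing.unit.
    apply/unitrP; exists (phi (ncexpr_eval X r)^-1).
    by rewrite -!phiM mulVr // divrr.
  by split=> //; apply: (mulrI u'); rewrite divrr // -phiM divrr.
Qed.

Lemma tens_scalar1 (k : fieldType) (m n : nat) (a : k) :
  (a%:M : 'M_m) *t (1%:M : 'M_n) = a%:M.
Proof.
apply/matrixP => i j; rewrite !mxE -(can_eq (@mxtens_unindexK m n)) xpair_eqE.
by rewrite -mulnb mulrnA mulr_natr.
Qed.

Lemma tens_1scalar (k : fieldType) (m n : nat) (a : k) :
  (1%:M : 'M_m) *t (a%:M : 'M_n) = a%:M.
Proof.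
apply/matrixP => i j; rewrite !mxE -(can_eq (@mxtens_unindexK m n)) xpair_eqE.
by rewrite -mulnb mulnC mulrnA mulr_natl.
Qed.

(** The size is convertible to [n.+1 * m.+1], written as the successor that [mxpoint] requires. *)
Definition tens1r (k : fieldType) (n m : nat) (A : 'M[k]_n.+1) :
  'M[k]_((m + n * m.+1).+1) := A *t (1%:M : 'M_m.+1).

Definition tens1l (k : fieldType) (n m : nat) (A : 'M[k]_m.+1) :
  'M[k]_((m + n * m.+1).+1) := (1%:M : 'M_n.+1) *t A.

Lemma tens1rD (k : fieldType) (n m : nat) :
  {morph @tens1r k n m : A B / A + B}.
Proof. by move=> A B; apply/matrixP => i j; rewrite !mxE mulrDl. Qed.

Lemma tens1rM (k : fieldType) (n m : nat) :
  {morph @tens1r k n m : A B / A * B}.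
Proof.
move=> A B; rewrite /tens1r -[RHS]/(_ *m _).
by rewrite (@tensmx_mul k n.+1 n.+1 m.+1 m.+1 n.+1 m.+1) mulmx1.
Qed.

Lemma tens1lD (k : fieldType) (n m : nat) :
  {morph @tens1l k n m : A B / A + B}.
Proof. by move=> A B; apply/matrixP => i j; rewrite !mxE mulrDr. Qed.

Lemma tens1lM (k : fieldType) (n m : nat) :
  {morph @tens1l k n m : A B / A * B}.
Proof.
move=> A B; rewrite /tens1l -[RHS]/(_ *m _).
by rewrite (@tensmx_mul k n.+1 n.+1 m.+1 m.+1 n.+1 m.+1) mulmx1.
Qed.

Lemma tens1r_inj (k : fieldType) (n m : nat) : injective (@tens1r k n m).
Proof.
move=> A B /matrixP e; apply/matrixP => i j.
have : (A *t (1%:M : 'M_m.+1)) (mxtens_index (i, ord0)) (mxtens_index (j, ord0))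
  = (B *t (1%:M : 'M_m.+1)) (mxtens_index (i, ord0)) (mxtens_index (j, ord0)).
  exact: e.
by rewrite !tensmxE mxE eqxx !mulr1.
Qed.

Definition line (k : fieldType) (g n : nat) (X0 X1 : mxpoint k g n) (i : 'I_g) :
  'M[{poly k}]_n.+1 :=
  map_mx polyC (X0 i) + 'X *: map_mx polyC (X1 i - X0 i).

Lemma curve_line (k : fieldType) (g n : nat) (X0 X1 : mxpoint k g n) (t : k) :
  curve (line X0 X1) t = fun i => X0 i + t *: (X1 i - X0 i).
Proof.
apply: functional_extensionality => i; apply/matrixP => a b.
by rewrite !mxE /horner_eval hornerD hornerM hornerX !hornerC.
Qed.

Lemma curve_line0 (k : fieldType) (g n : nat) (X0 X1 : mxpoint k g n) :
  curve (line X0 X1) 0 = X0.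
Proof.
by rewrite curve_line; apply: functional_extensionality => i; rewrite scale0r addr0.
Qed.

Lemma curve_line1 (k : fieldType) (g n : nat) (X0 X1 : mxpoint k g n) :
  curve (line X0 X1) 1 = X1.
Proof.
by rewrite curve_line; apply: functional_extensionality => i; rewrite scale1r addrC subrK.
Qed.

Lemma curve_ray (k : fieldType) (g n : nat) (X : mxpoint k g n) (t : k) :
  curve (line (fun=> 0) X) t = fun i => t *: X i.
Proof.
rewrite curve_line; apply: functional_extensionality => i.
by rewrite subr0 add0r.
Qed.

(* The class representative of [f] need not be defined anywhere at the size    *)
(* where [s1] and [s2] are compared, so the comparison is made at a common     *)
(* multiple of the sizes.                                                      *)
Lemma represents_equiv (k : fieldType) (char_k0 : [pchar k] =i pred0) (g : nat)
    (f : ncratfun k g) (s1 s2 : ncexpr k g) :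
  f s1 -> f s2 -> ncexpr_equiv s1 s2.
Proof.
case: f => f [r [N [X0 dX0]] fE] /=.
move=> /fE[_ e1] /fE[_ e2] n X d1 d2; apply: (@tens1r_inj k n N).
have [d1' <-] := ncexpr_hom (@tens1rD k n N) (@tens1rM k n N)
  (@tens_scalar1 k n.+1 N.+1) d1.
have [d2' <-] := ncexpr_hom (@tens1rD k n N) (@tens1rM k n N)
  (@tens_scalar1 k n.+1 N.+1) d2.
have [d0' _] := ncexpr_hom (@tens1lD k n N) (@tens1lM k n N)
  (@tens_1scalar k n.+1 N.+1) dX0.
move: d0' d1' d2'; set X' := fun i => tens1r N (X i); set X'' := fun i => _.
(* [s1] and [s2] are defined at [t = 0] and [r] at [t = 1], so all three are defined for generic
   [t], where [r] mediates; the identity then specializes to [t = 0]. *)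
pose Y := line X' X''.
have -> : X' = curve Y 0 by rewrite curve_line0.
have -> : X'' = curve Y 1 by rewrite curve_line1.
move=> /ncexpr_curve[q [P [q1 eP]]].
move=> /ncexpr_curve[q1' [P1 [q10 eP1]]].
move=> /ncexpr_curve[q2 [P2 [q20 eP2]]].
have E : q2 *: P1 = q1' *: P2.
  apply: (@polymx_generic _ char_k0 _ _ (q * q1' * q2)).
    by rewrite !mulf_neq0 //; [apply: horner_neq0_poly q1 |
      apply: horner_neq0_poly q10 | apply: horner_neq0_poly q20].
  move=> t; rewrite !hornerM !mulf_eq0 !negb_or -andbA => /and3P[qt q1t q2t].
  have [dr _] := eP _ qt; have [ds1 h1] := eP1 _ q1t.
  have [ds2 h2] := eP2 _ q2t.
  rewrite !map_mxZ -h1 -h2 !scalerA [q2.[t] * _]mulrC.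
  by rewrite -(e1 _ _ dr ds1) -(e2 _ _ dr ds2).
have [_ h1] := eP1 _ q10; have [_ h2] := eP2 _ q20.
have := congr1 (map_mx (horner_eval 0)) E.
rewrite !map_mxZ -h1 -h2 !scalerA /horner_eval [q2.[0] * _]mulrC.
by apply: scalerI; rewrite mulf_neq0.
Qed.

(** * Induction from minimality *)

(** By excluded middle, a row space inside [S] is all of [S] or gains rank from one more vector;
    rank [d + 1] is impossible. *)
Lemma invariant_pred_mx (k : fieldType) (d : nat) (S : 'rV[k]_d -> Prop) :
  S 0 -> (forall x y, S x -> S y -> S (x + y)) ->
  (forall (a : k) x, S x -> S (a *: x)) ->
  exists B : 'M[k]_d, forall x, S x <-> (x <= B)%MS.
Proof.
move=> S0 SD SZ.
have grow m : (exists2 B : 'M[k]_d,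
      forall x : 'rV_d, (x <= B)%MS -> S x & (m <= \rank B)%N) \/
    (exists B : 'M[k]_d, forall x, S x <-> (x <= B)%MS).
  elim: m => [|m [[B BS mB]|]]; last by right.
    by left; exists 0 => // x; rewrite submx0 => /eqP->.
  have [[x [Sx nxB]]|nex] := classic (exists x, S x /\ ~~ (x <= B)%MS); last first.
    right; exists B => x; split=> [Sx|/BS//].
    by case: (boolP (x <= B)%MS) => // nxB; case: nex; exists x.
  left; exists (B + x)%MS.
    move=> y /sub_addsmxP[[u1 u2] ->] /=; apply: SD.
      by apply: BS; rewrite submxMl.
    by rewrite [u2]mx11_scalar mul_scalar_mx; apply: SZ.
  apply: leq_trans (_ : \rank B < _)%N => //.
  rewrite ltn_neqAle mxrankS ?addsmxSl // andbT.
  rewrite (mxrank_leqif_sup (addsmxSl B x)).2; apply: contra nxB.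
  exact: submx_trans (addsmxSr B x).
have [[B _]|//] := grow d.+1.
by rewrite ltnNge rank_leq_row.
Qed.

Lemma observable_ind (k : fieldType) (g d : nat) (A : 'I_g -> 'M[k]_d)
    (c : 'rV[k]_d) (S : 'rV[k]_d -> Prop) :
  observable A c -> S c -> (forall x y, S x -> S y -> S (x + y)) ->
  (forall (a : k) x, S x -> S (a *: x)) -> (forall i x, S x -> S (x *m A i)) ->
  forall x, S x.
Proof.
move=> obs Sc SD SZ SA.
have S0 : S 0 by rewrite -(scale0r c); apply: SZ.
have [B BE] := invariant_pred_mx S0 SD SZ.
have /submx_full fB : row_full B.
  apply: obs => [|i]; first exact/BE.
  by apply/row_subP => j; rewrite row_mul; apply/BE/SA/BE; apply: row_sub.
by move=> x; apply/BE/fB.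
Qed.

(** * Absence of poles at [t = 1] *)

(** The output [M y] is the rational function [P / q], without pole at 1, for [t] off the finitely
    many roots of [e]. Existence of [M] is not asserted. *)
Definition regular_at1 (k : fieldType) (g d n : nat) (A : 'I_g -> 'M[k]_d)
    (X : mxpoint k g n) (M0 : 'M[k]_(n.+1, d)) (y : 'cV[k]_d) : Prop :=
  exists (e q : {poly k}) (P : 'cV[{poly k}]_n.+1),
    [/\ e != 0, q.[1] != 0 & forall t M, e.[t] != 0 ->
      M = t *: sylv X A M + M0 -> q.[t] *: (M *m y) = map_mx (horner_eval t) P].

Lemma ncexpr_dom_zero (k : fieldType) (g n : nat) (r : ncexpr k g) :
  ncexpr_dom r (fun=> 0 : 'M_(0.+1)) -> ncexpr_dom r (fun=> 0 : 'M_(n.+1)).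
Proof.
pose phi (A : 'M[k]_1) : 'M[k]_n.+1 := (A 0 0)%:M.
have phiD : {morph phi : A B / A + B} by move=> A B; rewrite /phi mxE raddfD.
have phiM : {morph phi : A B / A * B}.
  by move=> A B; rewrite /phi mxE big_ord1 scalar_mxM.
have phiC a : phi a%:M = a%:M by rewrite /phi mxE mulr1n.
move=> /(ncexpr_hom phiD phiM phiC)[+ _].
by rewrite (_ : phi 0 = 0) // -(raddf0 (@scalar_mx k 1)) phiC raddf0.
Qed.

(** [r0] is defined at 0, hence at [tX] for generic [t], where the realization gives uniqueness and
    so solvability. *)
Lemma sylv_generic_surj (k : fieldType) (g d n : nat) (r0 : ncexpr k g)
    (A : 'I_g -> 'M[k]_d) b c (X : mxpoint k g n) :
  ncexpr_dom r0 (fun=> 0 : 'M_(0.+1)) ->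
  realizes (fun n (X : mxpoint k g n) => ncexpr_eval X r0)
    (fun n X => ncexpr_dom r0 X) 1%:M A b c ->
  exists2 e : {poly k}, e != 0 & forall t, e.[t] != 0 ->
    forall N, exists M, M = t *: sylv X A M + N.
Proof.
move=> /(ncexpr_dom_zero n); rewrite -(curve_line0 (fun=> 0) X) => /ncexpr_curve.
move=> [q [P [q0 eP]]] R; exists q; first exact: horner_neq0_poly q0.
move=> t /eP[+ _] N; rewrite curve_ray => /R[inj _].
have /sylv_inj_surj/(_ N)[M eM] :
    forall M, M = sylv (fun i => t *: X i) A M -> M = 0.
  by move=> M h; apply: inj; rewrite mulmx1.
by exists M; rewrite -sylv_scale_point.
Qed.

(** For generic [t] the output is [r0(tX) v = s(tX) v], where the representative [s] is defined at
    [X] itself, that is, at [t = 1]. *)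
Lemma regular_at1_output (k : fieldType) (char_k0 : [pchar k] =i pred0)
    (g d n : nat) (f : ncratfun k g) (r0 : ncexpr k g)
    (A : 'I_g -> 'M[k]_d) b c (X : mxpoint k g n) (v : 'cV[k]_n.+1) :
  regular f -> f r0 -> ncexpr_dom r0 (fun=> 0 : 'M_(0.+1)) ->
  realizes (fun n (X : mxpoint k g n) => ncexpr_eval X r0)
    (fun n X => ncexpr_dom r0 X) 1%:M A b c ->
  regular_at1 A X (v *m c) b.
Proof.
move=> freg fr0 /(ncexpr_dom_zero n) d0 R; have [s fs ds] := freg n X.
have {}d0 : ncexpr_dom r0 (curve (line (fun=> 0) X) 0) by rewrite curve_line0.
have {}ds : ncexpr_dom s (curve (line (fun=> 0) X) 1) by rewrite curve_line1.
move: d0 ds => /ncexpr_curve[q0 [P0 [q00 eP0]]] /ncexpr_curve[q [P [q1 eP]]].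
exists (q0 * q), q, (P *m map_mx polyC v); split=> //.
  by rewrite mulf_neq0 ?(horner_neq0_poly q00) ?(horner_neq0_poly q1).
move=> t M; rewrite hornerM mulf_eq0 negb_or => /andP[/eP0[+ _] /eP[+ h]] eM.
rewrite curve_ray in h *; move=> d0 ds.
have [_ out] := R _ _ d0.
rewrite (out M v) ?mulmx1 ?sylv_scale_point //.
rewrite (represents_equiv char_k0 fr0 fs d0 ds) scalemxAl h map_mxM.
congr (_ *m _); apply/matrixP => i j.
by rewrite !mxE /= /horner_eval hornerC.
Qed.

Lemma sylv_col_block (k : fieldType) (g d n : nat) (A : 'I_g -> 'M[k]_d)
    (X Z Y : 'I_g -> 'M[k]_n.+1) (M1 M2 : 'M[k]_(n.+1, d)) :
  sylv (fun i => block_mx (X i) (Z i) 0 (Y i) : 'M_((n + n.+1).+1)) A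
    (col_mx M1 M2 : 'M_((n + n.+1).+1, d)) =
  col_mx (sylv X A M1 + sylv Z A M2) (sylv Y A M2).
Proof.
(* The same statement at the convertible size [n.+1 + n.+1], where the block lemmas apply. *)
suff: \sum_i block_mx (X i) (Z i) 0 (Y i) *m col_mx M1 M2 *m A i =
  col_mx (sylv X A M1 + sylv Z A M2) (sylv Y A M2) by exact.
rewrite /sylv -big_split /=.
rewrite (eq_bigr (fun i => col_mx (X i *m M1 *m A i + Z i *m M2 *m A i)
  (Y i *m M2 *m A i))); last first.
  by move=> i _; rewrite mul_block_col mul0mx add0r mul_col_mx mulmxDl.
elim/big_rec3: _ => [|i x y z _ ->]; first by rewrite col_mx0.
by rewrite add_col_mx.
Qed.

Lemma sylv_coord (k : fieldType) (g d n : nat) (A : 'I_g -> 'M[k]_d)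
    (i : 'I_g) (M : 'M[k]_(n.+1, d)) :
  sylv (fun j => (j == i)%:R%:M) A M = M *m A i.
Proof.
rewrite /sylv (bigD1 i) //= eqxx mul1mx big1 ?addr0 // => j /negPf->.
by rewrite raddf0 mul0mx mul0mx.
Qed.

(** The top block of the solution at [X'] is [t M B]; the factor [t] joins the denominator as ['X],
    which is 1 at [t = 1]. *)
Lemma regular_at1_shift (k : fieldType) (g d n : nat) (A : 'I_g -> 'M[k]_d)
    (X : mxpoint k g n) (X' : mxpoint k g (n + n.+1)) (M0 : 'M[k]_(n.+1, d))
    (M0' : 'M[k]_((n + n.+1).+1, d)) (B : 'M[k]_d) (y : 'cV[k]_d) :
  regular_at1 A X' M0' y ->
  (forall t M, M = t *: sylv X A M + M0 -> exists M2,
    (col_mx (t *: (M *m B)) M2 : 'M_((n + n.+1).+1, d)) =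
      t *: sylv X' A (col_mx (t *: (M *m B)) M2) + M0') ->
  regular_at1 A X M0 (B *m y).
Proof.
move=> [e [q [P [e0 q1 h]]]] ext.
exists e, (q * 'X), (usubmx (P : 'cV_(n.+1 + n.+1))); split=> //.
  by rewrite hornerM hornerX mulr1.
move=> t M et /ext[M2 /(h _ _ et) E].
have {}E : q.[t] *: (col_mx (t *: (M *m B)) M2 *m y) =
  (map_mx (horner_eval t) P : 'cV_(n.+1 + n.+1)) by [].
rewrite map_usubmx -E mul_col_mx scale_col_mx col_mxKu.
by rewrite hornerM hornerX mulmxA -scalemxAl scalerA.
Qed.

(* [X' = [[X, 1_i], [0, 0]]] turns the free term [v x] into [v x A_i].         *)
Lemma regular_at1_rowA (k : fieldType) (g d : nat) (A : 'I_g -> 'M[k]_d)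
    (b : 'cV[k]_d) (x : 'rV[k]_d) (i : 'I_g) :
  (forall n (X : mxpoint k g n) v, regular_at1 A X (v *m x) b) ->
  forall n (X : mxpoint k g n) v, regular_at1 A X (v *m (x *m A i)) b.
Proof.
move=> h n X v; rewrite -[b]mul1mx.
pose X' : mxpoint k g (n + n.+1) :=
  fun j => block_mx (X j) ((j == i)%:R%:M) 0 0.
apply: (regular_at1_shift (h _ X' (col_mx 0 v : 'cV_(n.+1 + n.+1)))).
move=> t M eM; exists (v *m x); rewrite mulmx1 sylv_col_block.
have -> : (col_mx 0 v : 'cV_(n.+1 + n.+1)) *m x = col_mx 0 (v *m x).
  by rewrite mul_col_mx mul0mx.
suff: col_mx (t *: M) (v *m x) =
  t *: col_mx (sylv X A (t *: M) + sylv (fun j => (j == i)%:R%:M) A (v *m x))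
    (sylv (fun=> 0) A (v *m x)) + col_mx 0 (v *m x) by exact.
rewrite scale_col_mx add_col_mx addr0 sylv_coord sylvZ.
rewrite -mulmxA -eM; congr col_mx.
by rewrite /sylv big1 ?scaler0 ?add0r // => j _; rewrite !mul0mx.
Qed.

(* [X' = [[0, 1_i], [0, X]]] turns the output [M y] into [M A_i y].            *)
Lemma regular_at1_Acol (k : fieldType) (g d : nat) (A : 'I_g -> 'M[k]_d)
    (y : 'cV[k]_d) (i : 'I_g) :
  (forall n (X : mxpoint k g n) M0, regular_at1 A X M0 y) ->
  forall n (X : mxpoint k g n) M0, regular_at1 A X M0 (A i *m y).
Proof.
move=> h n X M0.
pose X' : mxpoint k g (n + n.+1) :=
  fun j => block_mx (0 : 'M_n.+1) ((j == i)%:R%:M) 0 (X j).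
apply: (regular_at1_shift (h _ X' (col_mx 0 M0 : 'M_(n.+1 + n.+1, d)))).
move=> t M eM; exists M; rewrite sylv_col_block.
suff: col_mx (t *: (M *m A i)) M =
  t *: col_mx (sylv (fun=> 0) A (t *: (M *m A i)) +
    sylv (fun j => (j == i)%:R%:M) A M) (sylv X A M) + col_mx 0 M0 by exact.
rewrite scale_col_mx add_col_mx addr0 sylv_coord -eM; congr col_mx.
by rewrite /sylv big1 ?add0r // => j _; rewrite !mul0mx.
Qed.

(** Splitting a solution for [M1 + M2] requires a solution for [M1], supplied by generic
    solvability. *)
Lemma regular_at1_addl (k : fieldType) (g d n : nat) (A : 'I_g -> 'M[k]_d)
    (X : mxpoint k g n) (e : {poly k}) (M1 M2 : 'M[k]_(n.+1, d)) y :
  e != 0 ->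
  (forall t, e.[t] != 0 -> forall N, exists M, M = t *: sylv X A M + N) ->
  regular_at1 A X M1 y -> regular_at1 A X M2 y -> regular_at1 A X (M1 + M2) y.
Proof.
move=> e0 surj [e1 [q1 [P1 [e10 q11 h1]]]] [e2 [q2 [P2 [e20 q21 h2]]]].
exists (e * e1 * e2), (q1 * q2), (q2 *: P1 + q1 *: P2).
rewrite !mulf_neq0 // hornerM mulf_neq0 //; split=> // t M.
rewrite !hornerM !mulf_eq0 !negb_or -andbA => /and3P[et e1t e2t] eM.
have [N1 eN1] := surj t et M1.
have eN2 : M - N1 = t *: sylv X A (M - N1) + M2.
  by rewrite sylvB scalerBr {1}eM {1}eN1 opprD addrACA [M1 + M2]addrC addrK.
rewrite -[M](subrK N1) mulmxDl scalerDr addrC map_mxD !map_mxZ /=.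
rewrite -(h1 _ _ e1t eN1) -(h2 _ _ e2t eN2) !scalerA /horner_eval.
by rewrite [q2.[t] * _]mulrC.
Qed.

Lemma regular_at1_addr (k : fieldType) (g d n : nat) (A : 'I_g -> 'M[k]_d)
    (X : mxpoint k g n) (M0 : 'M[k]_(n.+1, d)) y1 y2 :
  regular_at1 A X M0 y1 -> regular_at1 A X M0 y2 ->
  regular_at1 A X M0 (y1 + y2).
Proof.
move=> [e1 [q1 [P1 [e10 q11 h1]]]] [e2 [q2 [P2 [e20 q21 h2]]]].
exists (e1 * e2), (q1 * q2), (q2 *: P1 + q1 *: P2).
rewrite mulf_neq0 // hornerM mulf_neq0 //; split=> // t M.
rewrite !hornerM !mulf_eq0 !negb_or => /andP[e1t e2t] eM.
rewrite mulmxDr scalerDr map_mxD !map_mxZ /= -(h1 _ _ e1t eM) -(h2 _ _ e2t eM).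
by rewrite !scalerA /horner_eval [q2.[t] * _]mulrC.
Qed.

Lemma regular_at1_scaler (k : fieldType) (g d n : nat) (A : 'I_g -> 'M[k]_d)
    (X : mxpoint k g n) (M0 : 'M[k]_(n.+1, d)) (a : k) y :
  regular_at1 A X M0 y -> regular_at1 A X M0 (a *: y).
Proof.
move=> [e [q [P [e0 q1 h]]]]; exists e, q, (a%:P *: P); split=> // t M et eM.
rewrite map_mxZ /= -(h _ _ et eM) /horner_eval hornerC -scalemxAr !scalerA.
by rewrite mulrC.
Qed.

(** Starting from free term [v c] and output [b], observability replaces [c] by any row, sums of
    rank-one terms give any [M0], and controllability replaces [b] by any [y]. *)
Lemma regular_at1_all (k : fieldType) (char_k0 : [pchar k] =i pred0)
    (g d : nat) (f : ncratfun k g) (r0 : ncexpr k g)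
    (A : 'I_g -> 'M[k]_d) b c :
  regular f -> f r0 -> ncexpr_dom r0 (fun=> 0 : 'M_(0.+1)) ->
  realizes (fun n (X : mxpoint k g n) => ncexpr_eval X r0)
    (fun n X => ncexpr_dom r0 X) 1%:M A b c ->
  observable A c -> controllable A b ->
  forall n (X : mxpoint k g n) M0 y, regular_at1 A X M0 y.
Proof.
move=> freg fr0 d0 R obs ctr.
have rows : forall (x : 'rV_d) n (X : mxpoint k g n) v, regular_at1 A X (v *m x) b.
  refine (@observable_ind _ _ _ _ _ (fun x => forall n (X : mxpoint k g n) v,
    regular_at1 A X (v *m x) b) obs _ _ _ _).
  - by move=> n X v; apply: regular_at1_output freg fr0 d0 R.
  - move=> x y hx hy n X v; have [e e0 surj] := sylv_generic_surj X d0 R.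
    by rewrite mulmxDr; apply: regular_at1_addl e0 surj (hx _ X v) (hy _ X v).
  - by move=> a x hx n X v; rewrite -scalemxAr scalemxAl.
  - by move=> i x hx; apply: regular_at1_rowA.
have out_b n (X : mxpoint k g n) M0 : regular_at1 A X M0 b.
  have -> : M0 = \sum_j delta_mx j (0 : 'I_1) *m row j M0.
    by rewrite -[LHS]mul1mx; apply/matrixP => i l; rewrite [LHS]mxE summxE;
      apply: eq_bigr => j _; rewrite [RHS]mxE big_ord1 !mxE andbT.
  have [e e0 surj] := sylv_generic_surj X d0 R.
  elim/big_ind: _ => [|M1 M2|j _]; last exact: rows.
    by rewrite -(mulmx0 _ (0 : 'cV_n.+1)); apply: rows.
  exact: regular_at1_addl e0 surj.
suff cols : forall (z : 'rV_d) n (X : mxpoint k g n) M0, regular_at1 A X M0 z^T.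
  by move=> n X M0 y; rewrite -[y]trmxK; apply: cols.
refine (@observable_ind _ _ _ _ _ (fun z => forall n (X : mxpoint k g n) M0,
  regular_at1 A X M0 z^T) ctr _ _ _ _).
- by rewrite trmxK.
- by move=> x y hx hy n X M0; rewrite raddfD; apply: regular_at1_addr.
- by move=> a x hx n X M0; rewrite linearZ; apply: regular_at1_scaler.
- by move=> i x hx n X M0; rewrite trmx_mul trmxK; apply: regular_at1_Acol.
Qed.

(* [W / (1 - t)] solves [M = t X.M.A + W] and has a pole at [t = 1].           *)
Lemma sylv_no_fixpoint (k : fieldType) (char_k0 : [pchar k] =i pred0)
    (g d n : nat) (A : 'I_g -> 'M[k]_d) (X : mxpoint k g n) (W : 'M[k]_(n.+1, d)) :
  (forall y, regular_at1 A X W y) -> W = sylv X A W -> W = 0.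
Proof.
move=> reg eW; suff h (y : 'cV_d) : W *m y = 0.
  apply/matrixP => i j; have /matrixP/(_ i 0) := h (delta_mx j 0).
  by rewrite -colE !mxE.
have [e [q [P [e0 q1 h]]]] := reg y.
(* For generic [t], [P = q W y / (1 - t)]; with denominators cleared, [t = 1] gives
   [q(1) W y = 0]. *)
have E : q *: map_mx polyC (W *m y) = (1 - 'X) *: P.
  have X1 : 1 - 'X != 0 :> {poly k}.
    by rewrite -oppr_eq0 opprB polyXsubC_eq0.
  apply: (@polymx_generic _ char_k0 _ _ (e * (1 - 'X))); first exact: mulf_neq0.
  move=> t; rewrite hornerM mulf_eq0 negb_or => /andP[et].
  rewrite hornerD hornerN hornerX hornerC => t1.
  have eM : (1 - t)^-1 *: W = t *: sylv X A ((1 - t)^-1 *: W) + W.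
    have e1t : (1 - t)^-1 = t * (1 - t)^-1 + 1.
      apply: (mulIf t1).
      by rewrite mulVf // mulrDl -mulrA mulVf // mulr1 mul1r addrC subrK.
    by rewrite sylvZ -eW {1}e1t scalerDl scale1r scalerA.
  rewrite !map_mxZ /= -(h _ _ et eM) /horner_eval !hornerE -scalemxAl !scalerA.
  rewrite mulrAC mulfV // mul1r; congr (_ *: _).
  by apply/matrixP => i j; rewrite !mxE /= /horner_eval hornerC.
have := congr1 (map_mx (horner_eval 1)) E; rewrite !map_mxZ /= /horner_eval.
rewrite !hornerE subrr scale0r => /eqP; rewrite scaler_eq0 (negPf q1) /=.
move/eqP/matrixP => h0; apply/matrixP => i j; have := h0 i j.
by rewrite !mxE /= hornerC.
Qed.

(** * Nilpotency and the terminating series *)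

(** The row space spanned by the rows of all products of [m] of the [A_i]. *)
Definition image_power (k : fieldType) (g d : nat) (A : 'I_g -> 'M[k]_d)
    (m : nat) : 'M[k]_d :=
  iter m (fun V => \sum_i <<V *m A i>>)%MS 1%:M.

(** The chain decreases; once it is stationary at [V], the coefficients expressing [V] through the
    [V A_i] form a point at which [V] is a fixed point, so [V = 0]. Until then the rank drops at
    each step. *)
Lemma image_power_eq0 (k : fieldType) (g d : nat) (A : 'I_g -> 'M[k]_d) :
  (forall n (X : mxpoint k g n) W, W = sylv X A W -> W = 0) ->
  image_power A d = 0.
Proof.
move=> nofix.
have step (V V' : 'M[k]_d) : (V <= V')%MS ->
    ((\sum_i <<V *m A i>>)%MS <= (\sum_i <<V' *m A i>>)%MS)%MS.
  move=> VV'; apply/sumsmx_subP => i _; apply: (sumsmx_sup i) => //.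
  by rewrite !genmxE submxMr.
have dec m : (image_power A m.+1 <= image_power A m)%MS.
  by elim: m => [|m IHm]; [exact: submx1 | exact: step].
have fixed (V : 'M[k]_d) : (V <= \sum_i <<V *m A i>>)%MS -> V = 0.
  (* The point built below has size [d], and sizes of points are positive. *)
  case: d A nofix {step dec} V => [|d] A nofix V; first by rewrite thinmx0.
  move=> /sub_sumsmxP[X eV].
  have eX i : (X i *m <<V *m A i>>%MS <= V *m A i)%MS.
    by rewrite (submx_trans (submxMl _ _)) // genmxE.
  (* [pinvmx] rewrites coefficients over the canonical basis [<<V *m A i>>] as coefficients over
     [V *m A i]. *)
  apply: (nofix d (fun i => X i *m <<V *m A i>>%MS *m pinvmx (V *m A i)) V).
  rewrite {1}eV; apply: eq_bigr => i _.
  by rewrite -mulmxA mulmxKpV.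
have rk m : (\rank (image_power A m) <= d - m)%N.
  elim: m => [|m IHm]; first by rewrite subn0 rank_leq_col.
  have [sub|nsub] := boolP (image_power A m <= image_power A m.+1)%MS.
    have z := fixed _ sub.
    by have := dec m; rewrite z submx0 => /eqP ->; rewrite mxrank0.
  have lt : (\rank (image_power A m.+1) < \rank (image_power A m))%N.
    by rewrite (ltn_leqif (mxrank_leqif_sup (dec m))).
  by rewrite subnS -ltnS (leq_trans lt) // (leq_trans IHm) // leqSpred.
by apply/eqP; rewrite -mxrank_eq0 -leqn0 -(subnn d) rk.
Qed.

Lemma iter_sylv_eq0 (k : fieldType) (g d n : nat) (A : 'I_g -> 'M[k]_d)
    (X : mxpoint k g n) (M : 'M[k]_(n.+1, d)) :
  image_power A d = 0 -> iter d (sylv X A) M = 0.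
Proof.
suff h m : (iter m (sylv X A) M <= image_power A m)%MS.
  by move=> z; apply/eqP; rewrite -submx0 -z h.
elim: m => [|m IHm]; first exact: submx1.
rewrite iterS; apply: summx_sub => i _; apply: (sumsmx_sup i) => //.
by rewrite genmxE submxMr // mulmx_sub.
Qed.

Lemma ncpoly_evalD (k : fieldType) (g n : nat) (X : mxpoint k g n) :
  {morph @ncpoly_eval k g n X : p q / p + q}.
Proof. exact: (mmapD (f := @scalar_mx k n.+1)). Qed.

Lemma ncpoly_eval0 (k : fieldType) (g n : nat) (X : mxpoint k g n) :
  ncpoly_eval X 0 = 0.
Proof. exact: (mmap0 (f := @scalar_mx k n.+1)). Qed.

Lemma iter_sylvD (k : fieldType) (g d n m : nat) (A : 'I_g -> 'M[k]_d)
    (X : mxpoint k g n) : {morph iter m (sylv X A) : M N / M + N}.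
Proof. by elim: m => // m IHm M N; rewrite !iterS IHm sylvD. Qed.

Lemma iter_sylv0 (k : fieldType) (g d n m : nat) (A : 'I_g -> 'M[k]_d)
    (X : mxpoint k g n) : iter m (sylv X A) 0 = 0.
Proof. by elim: m => // m IHm; rewrite iterS IHm sylv0. Qed.

(** Generalized over [w] and [x] because one application of [sylv] turns [w v x] into the sum of the
    [(i :: w) v (x A_i)]. *)
Lemma iter_sylv_ncpoly (k : fieldType) (g d : nat) (A : 'I_g -> 'M[k]_d)
    (b : 'cV[k]_d) (m : nat) (w : seq 'I_g) (x : 'rV[k]_d) :
  exists p : ncpoly k g, forall n (X : mxpoint k g n) v, ncpoly_eval X p *m v =
    iter m (sylv X A) ((\prod_(i <- w) X i : 'M_n.+1) *m v *m x) *m b.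
Proof.
elim: m w x => [|m IHm] w x.
  exists << (x *m b) 0 0 *g FMonom w >> => n X v.
  rewrite /ncpoly_eval (mmapU (f := @scalar_mx k n.+1)) /=.
  rewrite -[RHS]mulmxA [x *m b]mx11_scalar mul_mx_scalar scalemxAl.
  by rewrite -mul_scalar_mx mxE mulr1n.
have [p pE] := fin_all_exists (fun i => IHm (i :: w) (x *m A i)).
exists (\sum_i p i) => n X v.
rewrite (big_morph _ (@ncpoly_evalD _ _ _ X) (ncpoly_eval0 X)) mulmx_suml.
rewrite iterSr {2}/sylv (big_morph _ (@iter_sylvD _ _ _ _ m A X) (iter_sylv0 m A X)).
rewrite mulmx_suml; apply: eq_bigr => i _; rewrite pE big_cons.
by rewrite -[X i * _]/(X i *m _) !mulmxA.
Qed.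

(** Since [sylv X A] has zero [d]-th iterate, the Neumann series cut at [d] terms solves the
    system. *)
Lemma realizes_ncpoly (k : fieldType) (g d : nat) F
    (D : forall n, mxpoint k g n -> bool) (A : 'I_g -> 'M[k]_d) b c :
  realizes F D 1%:M A b c -> image_power A d = 0 ->
  exists p : ncpoly k g, forall n (X : mxpoint k g n), D n X ->
    F n X = ncpoly_eval X p.
Proof.
move=> R z; have [p pE] :=
  fin_all_exists (fun m : 'I_d => iter_sylv_ncpoly A b m [::] c).
exists (\sum_m p m) => n X /R[_ out].
suff h (v : 'cV_n.+1) : F n X *m v = ncpoly_eval X (\sum_m p m) *m v.
  apply/matrixP => i j; have /matrixP/(_ i 0) := h (delta_mx j 0).
  by rewrite -!colE !mxE.
pose M := \sum_(m < d) iter m (sylv X A) (v *m c).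
rewrite -(out M); last first.
  have sylv_sum : {morph sylv X A : M N / M + N} by exact: sylvD.
  rewrite mulmx1 /M (big_morph _ sylv_sum (sylv0 X A)).
  rewrite addrC -[X in X + _]/(iter 0 (sylv X A) _).
  rewrite -(big_ord_recl d (fun m => iter m (sylv X A) (v *m c))).
  by rewrite big_ord_recr /= iter_sylv_eq0 // addr0.
rewrite /M mulmx_suml (big_morph _ (@ncpoly_evalD _ _ _ X) (ncpoly_eval0 X)).
rewrite mulmx_suml; apply: eq_bigr => m _.
by rewrite pE big_nil -[1 *m _]/(1%:M *m _) mul1mx.
Qed.

Theorem theorem2 (k : fieldType) (char_k0 : [pchar k] =i pred0) (g : nat)
    (f : ncratfun k g) (f_regular : regular f) : is_ncpoly f.
Proof.
have [r0 fr0 d0] := f_regular 0%N (fun=> 0).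
have [d0' [P0 [P [b0 [c0 R0]]]]] := realizable_ncexpr r0.
have [A0 [b0' {}R0]] := realizes_normalize d0 R0.
have [d [A [b [c [R obs ctr]]]]] := exists_minimal_realization R0.
have reg := regular_at1_all char_k0 f_regular fr0 d0 R obs ctr.
have [|p pE] := realizes_ncpoly R.
  apply: image_power_eq0 => n X W.
  by apply: sylv_no_fixpoint => // y; apply: reg.
exists p; case: f f_regular fr0 reg => f [r rnd fE] /= f_regular fr0 _.
apply/fE; split; first by exists 0%N, (fun=> 0).
have [_ e0] := (fE r0).1 fr0.
move=> n X dr _ /=.
(* [r0] need not be defined at [X]: on the ray [tX], [r], [r0] and [p] agree for generic [t], and
   clearing denominators carries [r = p] to [t = 1]. *)
have {}d0 : ncexpr_dom r0 (curve (line (fun=> 0) X) 0).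
  by rewrite curve_line0; apply: ncexpr_dom_zero.
have {}dr : ncexpr_dom r (curve (line (fun=> 0) X) 1) by rewrite curve_line1.
have [q0 [Q0 [q00 h0]]] := ncexpr_curve d0.
have [q [Q [q1 h]]] := ncexpr_curve dr.
have : ncexpr_dom (NCPoly p) (curve (line (fun=> 0) X) 1) by [].
move=> /ncexpr_curve[q' [Q' [q1' h']]].
have E : q' *: Q = q *: Q'.
  apply: (@polymx_generic _ char_k0 _ _ (q0 * q * q')).
    by rewrite !mulf_neq0 ?(horner_neq0_poly q00) ?(horner_neq0_poly q1)
      ?(horner_neq0_poly q1').
  move=> t; rewrite !hornerM !mulf_eq0 !negb_or -andbA => /and3P[].
  move=> /h0[d0t _] /h[drt ht] /h'[_ ht'].
  rewrite !map_mxZ /= -ht -ht' !scalerA /horner_eval [q'.[t] * _]mulrC.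
  by rewrite (e0 _ _ drt d0t) (pE _ _ d0t).
have [_ h1] := h _ q1; have [_ h1'] := h' _ q1'.
have := congr1 (map_mx (horner_eval 1)) E.
rewrite !map_mxZ /= -h1 -h1' !scalerA /horner_eval [q'.[1] * _]mulrC curve_line1.
by apply: scalerI; rewrite mulf_neq0.
Qed.
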